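(* Let $F$ be a field of characteristic not two and let $E$ be a finite-dimensional vector space over $F$ with an arbitrary symmetric bilinear form $(U,V)\mapsto U\cdot V$. If $U,V,W\in E$ are collinear points, then the quadrances $Q_W=Q(U,V)$, $Q_U=Q(V,W)$ and $Q_V=Q(U,W)$ satisfy $$(Q_U+Q_V+Q_W)^2=2\left(Q_U^2+Q_V^2+Q_W^2\right).$$
   Context: Elements of $E$ are called points or vectors. The quadrance between points $U$ and $V$ is $Q(U,V)=(V-U)\cdot(V-U)$. Points are collinear when they lie on a common (affine) line of $E$. The bilinear form is not assumed non-degenerate. *)

(* Defs.v *)
From HB Require Import structures.
From mathcomp Require Import all_boot all_order all_algebra.

Set Implicit Arguments.
Unset Strict Implicit.
Unset Printing Implicit Defensive.

Import GRing.Theory.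
Local Open Scope ring_scope.

Definition quadrance (F : fieldType) (E : vectType F)
    (dot : {symmetric E}) (U V : E) : F :=
  dot (V - U) (V - U).

Definition affine_line (F : fieldType) (E : vectType F) (P d : E) : pred E :=
  [pred X | X - P \in <[d]>%VS].

(* The condition d != 0 excludes the case where P + <[d]> is a single point. *)
Definition collinear (F : fieldType) (E : vectType F) (U V W : E) : Prop :=
  exists P d : E, d != 0 /\
    [/\ U \in affine_line P d, V \in affine_line P d & W \in affine_line P d].

(* Main.v *)
Require Import Defs.
From mathcomp Require Import all_boot all_order all_algebra.
From mathcomp Require Import ring.

Import GRing.Theory.

Local Open Scope ring_scope.

(** On the line P + <[d]> a point is a scalar parameter, and the quadrance of
the points with parameters s and t is (t - s)^2 * dot d d
([quadrance_line]). The three quadrances of points with parameters a, b, c are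
therefore k * x^2, k * y^2, k * z^2, where k = dot d d and
x = b - a, y = c - b, z = c - a satisfy z = x + y. The claim is k^2 times the
identity (x^2 + y^2 + (x + y)^2)^2 = 2 * (x^4 + y^4 + (x + y)^4), which holds
in any commutative ring. Null directions (k = 0) and repeated points are
covered by the same computation. *)

Lemma affine_lineP (F : fieldType) (E : vectType F) (P d X : E) :
  reflect (exists t : F, X = P + t *: d) (X \in affine_line P d).
Proof.
rewrite inE; apply: (iffP (vlineP _ _)) => -[t eX]; exists t.
  by rewrite -eX addrC subrK.
by rewrite eX addrC addKr.
Qed.

Lemma quadrance_line (F : fieldType) (E : vectType F) (dot : {symmetric E})
    (P d : E) (s t : F) :
  quadrance dot (P + s *: d) (P + t *: d) = (t - s) ^+ 2 * dot d d.
Proof.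
rewrite /quadrance opprD addrACA subrr add0r -scalerBl.
by rewrite linearZl_LR linearZr_LR /= mulrA -expr2.
Qed.

Theorem theorem1 (F : fieldType) (char_neq2 : 2%N \notin [pchar F])
    (E : vectType F) (dot : {symmetric E}) (U V W : E)
    (collUVW : collinear U V W) :
  let Q_W := quadrance dot U V in
  let Q_U := quadrance dot V W in
  let Q_V := quadrance dot U W in
  (Q_U + Q_V + Q_W) ^+ 2 = 2%:R * (Q_U ^+ 2 + Q_V ^+ 2 + Q_W ^+ 2).
Proof.
have [P [d [_ [/affine_lineP[a ->] /affine_lineP[b ->] /affine_lineP[c ->]]]]] :=
  collUVW.
move=> Q_W Q_U Q_V; rewrite /Q_W /Q_U /Q_V !quadrance_line.
by ring.
Qed.
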